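(* Let $b>0$ and $y_{\mathrm{min}}<y_{\mathrm{max}}$ be real numbers, and let $r\in\mathcal{R}$ satisfy $$\sqrt{b}\cdot\frac{y_{\mathrm{max}}-y_{\mathrm{min}}}{2}\le r\Bigl(\frac{y_{\mathrm{min}}+y_{\mathrm{max}}}{2}\Bigr).$$ Let $f=f^{(r)}:\mathbb{R}^2\to\mathbb{R}$ be the condensed energy. Define $$\widetilde{Y}=\{y\in\mathbb{R}^2: y_1\le y_{\mathrm{min}}\text{ or }y_1\ge y_{\mathrm{max}}\},$$ $$Y_1=\{y\in\mathbb{R}^2: |y_2|<r_0(y_1)\},$$ $$Y_2=\Bigl\{y\in(y_{\mathrm{min}},y_{\mathrm{max}})\times\mathbb{R}: r_0(y_1)\le|y_2|<\frac{b+1}{\sqrt{b}}\frac{y_{\mathrm{max}}-y_{\mathrm{min}}}{2}-\frac{r_0(y_1)}{b}\Bigr\},$$ $$Y_3=\Bigl\{y\in(y_{\mathrm{min}},y_{\mathrm{max}})\times\mathbb{R}: \frac{b+1}{\sqrt{b}}\frac{y_{\mathrm{max}}-y_{\mathrm{min}}}{2}-\frac{r_0(y_1)}{b}\le|y_2|\le\frac{b+1}{\sqrt{b}}\frac{y_{\mathrm{max}}-y_{\mathrm{min}}}{2}\Bigr\},$$ $$Y_4=\Bigl\{y\in(y_{\mathrm{min}},y_{\mathrm{max}})\times\mathbb{R}: \frac{b+1}{\sqrt{b}}\frac{y_{\mathrm{max}}-y_{\mathrm{min}}}{2}<|y_2|\Bigr\}.$$ Then the convex envelope $f_{\mathrm{c}}$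 of $f$ is given by: - on $\widetilde{Y}$: $f_{\mathrm{c}}(y)=\frac12 y_1^2+\frac12\frac{b}{b+1}y_2^2$; - on $Y_1$: $f_{\mathrm{c}}(y)=\frac12 y_1^2+\frac12 y_2^2$; - on $Y_2$: $f_{\mathrm{c}}(y)=\frac12 y_1^2+\frac12 y_2^2-\frac{(|y_2|-r_0(y_1))^2}{2(b+1)}$; - on $Y_3$: $f_{\mathrm{c}}(y)=\frac12 y_1^2+\frac12 y_2^2-\frac{(|y_2|-r_0(y_1))^2}{2(b+1)}-\frac12\frac{b}{b+1}\left(|y_2|-\frac{b+1}{\sqrt{b}}\frac{y_{\mathrm{max}}-y_{\mathrm{min}}}{2}+\frac{r_0(y_1)}{b}\right)^2$; - on $Y_4$: $f_{\mathrm{c}}(y)=\frac12 y_1^2+\frac12\frac{b}{b+1}y_2^2+\frac12(y_1-y_{\mathrm{min}})(y_{\mathrm{max}}-y_1)$.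
   Context: For fixed $b>0$ and $y_{\mathrm{min}}<y_{\mathrm{max}}$, the set of admissible dissipation functions is $$\mathcal{R}=\{r\in C(\mathbb{R},[0,\infty)): \operatorname{supp}(r)=[y_{\mathrm{min}},y_{\mathrm{max}}],\ r|_{[y_{\mathrm{min}},y_{\mathrm{max}}]}\text{ concave}\},$$ where $\operatorname{supp}$ denotes the (closed) support. Put $y_{\mathrm{mid}}=(y_{\mathrm{min}}+y_{\mathrm{max}})/2$ and define the piecewise affine function $r_0\in\mathcal{R}$ by $$r_0(y_1)=\sqrt{b}\left(\frac{y_{\mathrm{max}}-y_{\mathrm{min}}}{2}-|y_1-y_{\mathrm{mid}}|\right)\chi_{[y_{\mathrm{min}},y_{\mathrm{max}}]}(y_1),$$ with $\chi$ the characteristic (indicator) function. For $r\in\mathcal{R}$ the condensed energy is $$f^{(r)}(y)=\frac12(y_1^2+y_2^2)-\frac{(|y_2|-r(y_1))_+^2}{2(b+1)},\qquad y=(y_1,y_2)\in\mathbb{R}^2,$$ where $(x)_+=\max\{0,x\}$ and $(x)_+^2=((x)_+)^2$. The convex envelope $f_{\mathrm{c}}$ of a function $f:\mathbb{R}^2\to\mathbb{R}$ is the largest convex function on $\mathbb{R}^2$ that is $\le f$ pointwise. *)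

(* Defs.v *)
(* Points of the plane are pairs in [R * R]; the [lmodType R] structure that
   [convex_function] needs is the one carried by [R^o * R^o]. *)
From mathcomp Require Export all_boot all_order all_algebra.
From mathcomp Require Export all_classical all_reals all_analysis.

Set Implicit Arguments.
Unset Strict Implicit.
Unset Printing Implicit Defensive.

Import Order.TTheory GRing.Theory Num.Theory.
Import numFieldNormedType.Exports.

Local Open Scope classical_set_scope.
Local Open Scope ring_scope.

Definition concave_function (R : numFieldType) (E : lmodType R)
    (D : set (convex_lmodType E)) (g : E -> R) : Prop :=
  convex_function D (fun x => - g x).

Definition closed_support (R : realType) (g : R -> R) : set R :=
  closure [set t | g t != 0].

Definition is_convex_envelope (R : realType) (E : lmodType R)
    (f fc : E -> R) : Prop :=
  [/\ convex_function setT fc,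
      forall y, fc y <= f y
    & forall h : E -> R, convex_function setT h ->
        (forall y, h y <= f y) -> forall y, h y <= fc y].

Lemma is_convex_envelope_unique (R : realType) (E : lmodType R)
    (f g h : E -> R) :
  is_convex_envelope f g -> is_convex_envelope f h -> g = h.
Proof.
move=> [cg gf gmax] [ch hf hmax]; apply/funext => y.
by apply/le_anti; rewrite (hmax _ cg gf) (gmax _ ch hf).
Qed.

Section CondensedEnergy.
Context {R : realType}.
Implicit Types (b ymin ymax : R) (r : R -> R).

Definition dissipation ymin ymax : set (R -> R) :=
  [set r : R -> R | [/\ continuous r,
                        forall t, 0 <= r t,
                        closed_support r = `[ymin, ymax]%classic
                      & concave_function (E := R^o) `[ymin, ymax]%classic r]].

Definition r0 b ymin ymax (t : R) : R :=
  Num.sqrt b * ((ymax - ymin) / 2 - `|t - (ymin + ymax) / 2|)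
  * \1_(`[ymin, ymax]%classic) t.

Definition condensed_energy b r (y : R * R) : R :=
  2^-1 * (y.1 ^+ 2 + y.2 ^+ 2)
  - Num.max 0 (`|y.2| - r y.1) ^+ 2 / (2 * (b + 1)).

Definition Ytilde ymin ymax : set (R * R) :=
  [set y | y.1 <= ymin \/ ymax <= y.1].

Definition Y1 b ymin ymax : set (R * R) :=
  [set y | `|y.2| < r0 b ymin ymax y.1].

Definition Y2 b ymin ymax : set (R * R) :=
  [set y | ymin < y.1 < ymax /\
    r0 b ymin ymax y.1 <= `|y.2|
      < (b + 1) / Num.sqrt b * ((ymax - ymin) / 2) - r0 b ymin ymax y.1 / b].

Definition Y3 b ymin ymax : set (R * R) :=
  [set y | ymin < y.1 < ymax /\
    (b + 1) / Num.sqrt b * ((ymax - ymin) / 2) - r0 b ymin ymax y.1 / b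
      <= `|y.2| <= (b + 1) / Num.sqrt b * ((ymax - ymin) / 2)].

Definition Y4 b ymin ymax : set (R * R) :=
  [set y | ymin < y.1 < ymax /\
    (b + 1) / Num.sqrt b * ((ymax - ymin) / 2) < `|y.2|].

End CondensedEnergy.

(* Main.v *)
(* Translate the midpoint of [ymin, ymax] to the origin and remove the affine
   part of [y1 ^+ 2 / 2]; write [L = (ymax - ymin) / 2] and [s = sqrt b].
   Concavity of [r] and [r_mid] give [r >= s * (L - |x|)].
   Every point is touched from below by an affine minorant of the energy:
   a tangent of [(x^2 + v^2) / 2] at a point of the closure of [Y1] (this covers
   [Y1] and [Y2]; the minorant property is Cauchy-Schwarz for [(s, 1)]), a
   function [const + c * v] with [|c| >= s * L] (this covers [Y3] and [Y4]), or
   a tangent of [x^2 / 2 + b / (b + 1) * v^2 / 2].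
   Conversely, convexity bounds the envelope from above along segments whose
   endpoints carry known values: horizontal ones between [x = -L] and [x = L]
   on [Y4], ones in the direction [(s, 1)] on [Y2], and, on [Y3], ones from the
   apex [(0, s * L)] to the top side of the triangle. *)
Require Import Defs.
From mathcomp Require Import ring lra.
Set Implicit Arguments.
Unset Strict Implicit.
Unset Printing Implicit Defensive.

Import Order.TTheory GRing.Theory Num.Theory.
Import numFieldNormedType.Exports.
Local Open Scope classical_set_scope.
Local Open Scope ring_scope.

(** This is the condensed energy with [b = s ^+ 2] and the midpoint moved to the origin, up to an
    affine function of [x]; such a function passes unchanged through the convex envelope. *)
Definition reduced_energy {R : realType} (s : R) (rho : R -> R) (x v : R) : R :=
  2^-1 * (x ^+ 2 + v ^+ 2)
  - Num.max 0 (`|v| - rho x) ^+ 2 / (2 * (s ^+ 2 + 1)).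

(** * Minorants of the reduced energy *)

Section Minorants.
Context {R : realType} (s L : R) (rho : R -> R).
Hypotheses (s_gt0 : 0 < s) (L_gt0 : 0 < L).
Hypotheses (rho_ge0 : forall x, 0 <= rho x).
Hypothesis (rho_ge : forall x, s * (L - `|x|) <= rho x).

Let s21_gt0 : 0 < s ^+ 2 + 1.
Proof. by rewrite ltr_wpDl ?sqr_ge0. Qed.

(** Squaring is monotone on nonnegative numbers, so [p] may replace the positive part; the minorants
    below come from suitable choices of [p]. *)
Lemma reduced_energy_ge (p x v : R) :
  0 <= p -> `|v| - rho x <= p ->
  2^-1 * (x ^+ 2 + v ^+ 2) - p ^+ 2 / (2 * (s ^+ 2 + 1))
    <= reduced_energy s rho x v.
Proof.
move=> p_ge0 le_p; rewrite lerD2l lerN2 ler_pM2r ?invr_gt0 ?mulr_gt0//.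
by rewrite lerXn2r ?nnegrE ?le_max ?lexx// ge_max p_ge0.
Qed.

Lemma quadratic_minorant (x v : R) :
  2^-1 * x ^+ 2 + 2^-1 * (s ^+ 2 / (s ^+ 2 + 1)) * v ^+ 2
    <= reduced_energy s rho x v.
Proof.
have le_v : `|v| - rho x <= `|v| by rewrite gerBl.
apply: le_trans (reduced_energy_ge (normr_ge0 v) le_v).
rewrite real_normK ?num_real// le_eqVlt; apply/orP; left; apply/eqP.
by field; rewrite gt_eqF.
Qed.

Lemma quadratic_tangent_minorant (x0 v0 x v : R) :
  x0 * x - 2^-1 * x0 ^+ 2
    + s ^+ 2 / (s ^+ 2 + 1) * (v0 * v - 2^-1 * v0 ^+ 2)
  <= reduced_energy s rho x v.
Proof.
apply: le_trans (quadratic_minorant x v).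
have k_gt0 : 0 < s ^+ 2 / (s ^+ 2 + 1) by rewrite divr_gt0 ?exprn_gt0.
rewrite -subr_ge0 [leRHS](_ : _ = 2^-1 * (x - x0) ^+ 2
  + 2^-1 * (s ^+ 2 / (s ^+ 2 + 1)) * (v - v0) ^+ 2).
  by rewrite !(sqr_ge0, ltW k_gt0, addr_ge0, mulr_ge0).
by field; rewrite gt_eqF.
Qed.

Lemma cauchy_schwarz2 (a c : R) :
  (c + s * a) ^+ 2 <= (s ^+ 2 + 1) * (a ^+ 2 + c ^+ 2).
Proof. by rewrite -subr_ge0 (_ : _ - _ = (a - s * c) ^+ 2) ?sqr_ge0//; ring. Qed.

(** The cone [s * (L - |x|)] is [s]-Lipschitz, so [p] dominates the excess [|v| - rho x]. By
    Cauchy-Schwarz, its contribution is at most half the squared distance to [(x0, v0)], which is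
    the gap between the isotropic quadratic and its tangent. *)
Lemma isotropic_tangent_minorant (x0 v0 x v : R) :
  `|v0| <= s * (L - `|x0|) ->
  x0 * x + v0 * v - 2^-1 * (x0 ^+ 2 + v0 ^+ 2) <= reduced_energy s rho x v.
Proof.
move=> le_v0; set p := `|v - v0| + s * `|x - x0|.
have p_ge0 : 0 <= p by rewrite addr_ge0 ?mulr_ge0// ltW.
have le_p : `|v| - rho x <= p.
  have := lerB_dist v v0.
  have : s * (`|x| - `|x0|) <= s * `|x - x0| by rewrite ler_pM2l ?lerB_dist.
  have := rho_ge x; rewrite /p; lra.
apply: le_trans (reduced_energy_ge p_ge0 le_p).
have : p ^+ 2 / (2 * (s ^+ 2 + 1)) <= 2^-1 * ((x - x0) ^+ 2 + (v - v0) ^+ 2).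
  have := cauchy_schwarz2 `|x - x0| `|v - v0|.
  rewrite -/p !real_normK ?num_real// ler_pdivrMr ?mulr_gt0// => p2_le.
  apply: le_trans p2_le _; rewrite le_eqVlt; apply/orP; left; apply/eqP.
  by field.
by move: (p ^+ 2 / _) => q; lra.
Qed.

(** With [k = s ^+ 2 / (s ^+ 2 + 1)], the terms in [c] form the tangent of slope [c] to
    [k * v ^+ 2 / 2]. In each of three regions, completing the square in [|v|] leaves a nonnegative
    remainder. *)
Lemma plate_minorant (c x v : R) :
  s * L <= `|c| ->
  2^-1 * L ^+ 2 + c * v - c ^+ 2 * (s ^+ 2 + 1) / (2 * s ^+ 2)
    <= reduced_energy s rho x v.
Proof.
move=> le_c; apply: (@le_trans _ _ (2^-1 * L ^+ 2 + `|c| * `|v|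
  - `|c| ^+ 2 * (s ^+ 2 + 1) / (2 * s ^+ 2))).
  by rewrite real_normK ?num_real// lerD2r lerD2l -normrM ler_norm.
have sn0 : s != 0 by rewrite gt_eqF.
have s21n0 : s ^+ 2 + 1 != 0 by rewrite gt_eqF.
have s2s_gt0 : 0 < s ^+ 2 / (s ^+ 2 + 1) by rewrite divr_gt0 ?exprn_gt0.
have [xL|Lx] := leP `|x| L; last first.
  apply: le_trans (quadratic_minorant x v).
  rewrite -(real_normK (num_real x)) -(real_normK (num_real v)) -subr_ge0.
  rewrite [leRHS](_ : _ = 2^-1 * (`|x| ^+ 2 - L ^+ 2) + 2^-1
    * (s ^+ 2 / (s ^+ 2 + 1)) * (`|v| - `|c| * (s ^+ 2 + 1) / s ^+ 2) ^+ 2).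
    rewrite ?(sqr_ge0, subr_ge0, ltW s2s_gt0, addr_ge0, mulr_ge0)//.
    by rewrite lerXn2r ?nnegrE// ltW.
  by field; rewrite sn0.
(* For [|v| <= rho x] the energy is isotropic, and the remainder is nonnegative exactly because
   [s * L <= |c|]. *)
have [vr|rv] := leP `|v| (rho x).
  have le0 : `|v| - rho x <= 0 by rewrite subr_le0.
  apply: le_trans (reduced_energy_ge (lexx 0) le0).
  rewrite -(real_normK (num_real v)) -subr_ge0.
  rewrite [leRHS](_ : _ = 2^-1 * x ^+ 2 + 2^-1 * (`|v| - `|c|) ^+ 2
    + (`|c| ^+ 2 - (s * L) ^+ 2) / (2 * s ^+ 2)).
    rewrite ?(sqr_ge0, subr_ge0, addr_ge0, mulr_ge0, invr_ge0)//.
    by rewrite lerXn2r ?nnegrE ?mulr_ge0 ?(ltW s_gt0) ?(ltW L_gt0).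
  by field; rewrite sn0.
(* Replacing [rho] by the cone below it enlarges the excess; the remainder is then a product of the
   two nonnegative factors [|c| - s * L] and [L - |x|], over [s]. *)
set p := `|v| - s * (L - `|x|).
have le_p : `|v| - rho x <= p by rewrite lerD2l lerN2.
have p_ge0 : 0 <= p by rewrite (le_trans _ le_p)// subr_ge0 ltW.
apply: le_trans (reduced_energy_ge p_ge0 le_p).
rewrite -(real_normK (num_real v)) -(real_normK (num_real x)) -subr_ge0.
rewrite [leRHS](_ : _ = 2^-1 * (s ^+ 2 / (s ^+ 2 + 1))
    * (`|v| - (`|c| * (s ^+ 2 + 1) - s * (L - `|x|)) / s ^+ 2) ^+ 2
  + (`|c| - s * L) * (L - `|x|) / s).
  rewrite ?(sqr_ge0, subr_ge0, ltW s2s_gt0, addr_ge0, mulr_ge0)//.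
  by rewrite invr_ge0 ltW.
by rewrite /p; field; rewrite sn0.
Qed.

End Minorants.

(** Unlike the usual sign, [e] squares to one even at [x = 0], so all four quadrants can be treated
    at once. *)
Lemma sign_decomposition (R : realType) (x : R) :
  exists2 e : R, e ^+ 2 = 1 & x = e * `|x|.
Proof. by exists ((-1) ^+ (x < 0)%R); rewrite ?sqrr_sign// -numEsign. Qed.

(** * Upper bounds for the envelope [g] in centred coordinates, by convexity *)

Section ReducedEnvelope.
Context {R : realType} (s L : R) (rho : R -> R) (g : R -> R -> R).
Hypotheses (s_gt0 : 0 < s) (L_gt0 : 0 < L).
Hypothesis (rho_ge : forall x, s * (L - `|x|) <= rho x).
Hypothesis (rho_out : forall x, L <= `|x| -> rho x = 0).
Hypothesis g_convex : forall t x x' v v' : R, 0 <= t <= 1 ->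
  g (t * x + (1 - t) * x') (t * v + (1 - t) * v')
    <= t * g x v + (1 - t) * g x' v'.
Hypothesis g_le : forall x v, g x v <= reduced_energy s rho x v.

Let s21_gt0 : 0 < s ^+ 2 + 1.
Proof. by rewrite ltr_wpDl ?sqr_ge0. Qed.

Let s21_neq0 : s ^+ 2 + 1 != 0.
Proof. by rewrite gt_eqF. Qed.

Let s_neq0 : s != 0.
Proof. by rewrite gt_eqF. Qed.

Let L_neq0 : L != 0.
Proof. by rewrite gt_eqF. Qed.

Lemma segment_le (t x x' v v' : R) (A A' B : R) :
  0 <= t <= 1 -> g x v <= A -> g x' v' <= A' ->
  t * A + (1 - t) * A' = B ->
  g (t * x + (1 - t) * x') (t * v + (1 - t) * v') <= B.
Proof.
move=> t01 gA gA' <-; apply: le_trans (g_convex _ _ _ _ t01) _.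
by case/andP: t01 => t0 t1; rewrite lerD// ler_wpM2l// subr_ge0.
Qed.

Lemma le_outside (x v : R) : L <= `|x| ->
  g x v <= 2^-1 * x ^+ 2 + 2^-1 * (s ^+ 2 / (s ^+ 2 + 1)) * v ^+ 2.
Proof.
move=> Lx; apply: le_trans (g_le x v) _.
rewrite /reduced_energy rho_out// subr0 max_r// real_normK ?num_real//.
by rewrite le_eqVlt; apply/orP; left; apply/eqP; field.
Qed.

Lemma le_elastic (x v : R) : `|v| <= s * (L - `|x|) ->
  g x v <= 2^-1 * (x ^+ 2 + v ^+ 2).
Proof.
move=> vx; apply: le_trans (g_le x v) _.
by rewrite /reduced_energy gerBl divr_ge0 ?sqr_ge0// mulr_ge0// ltW.
Qed.

(** The bounds at [x = L] and [x = - L] on the same height coincide, so their convex combination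
    does not depend on [x]. *)
Lemma le_horizontal (x v : R) : `|x| <= L ->
  g x v <= 2^-1 * L ^+ 2 + 2^-1 * (s ^+ 2 / (s ^+ 2 + 1)) * v ^+ 2.
Proof.
rewrite ler_norml => /andP[Lx xL]; set B := leRHS.
have nL : L <= `|- L| by rewrite normrN ger0_norm ?(ltW L_gt0).
have pL : L <= `|L| by rewrite ger0_norm ?(ltW L_gt0).
have L2_gt0 : 0 < 2 * L by rewrite mulr_gt0.
have t01 : 0 <= (x + L) / (2 * L) <= 1.
  by rewrite ler_pdivlMr// ler_pdivrMr// !mul0r; lra.
have := segment_le t01 (le_outside v pL) (le_outside v nL) (B := B).
rewrite (_ : _ * L + _ = x); last by field; rewrite ?s21_neq0 ?L_neq0.
rewrite (_ : _ * v + _ = v); last by field; rewrite ?s21_neq0 ?L_neq0.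
by apply; rewrite /B; field; rewrite ?s21_neq0 ?L_neq0.
Qed.

(** Up to the signs [d] and [e], this projects the point orthogonally onto an edge of the rhombus
    [|v| <= s * (L - |x|)]; [u] is the displacement along [(s, 1)]. The upper bound on [|v|] keeps
    the foot from passing the apex, that is, [0 <= a]. *)
Lemma normal_foot (x v : R) : `|x| < L ->
  s * (L - `|x|) <= `|v| -> `|v| < s * L + `|x| / s ->
  exists d e a u : R, [/\ d ^+ 2 = 1, e ^+ 2 = 1, 0 <= a & 0 <= u] /\
    [/\ `|x| = a + s * u, `|v| = s * (L - a) + u,
        x = d * (a + s * u) & v = e * (s * (L - a) + u)].
Proof.
move=> xL vge vlt.
have [d d2 dx] := sign_decomposition x; have [e e2 ev] := sign_decomposition v.
pose u := (`|v| - s * (L - `|x|)) / (s ^+ 2 + 1).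
pose a := `|x| - s * u.
have xE : `|x| = a + s * u by rewrite /a subrK.
have vE : `|v| = s * (L - a) + u by rewrite /a /u; field.
exists d, e, a, u; rewrite -xE -vE; split; split => //.
  have sv : `|v| * s < s ^+ 2 * L + `|x|.
    rewrite -ltr_pdivlMr// (lt_le_trans vlt)// le_eqVlt; apply/orP; left.
    by apply/eqP; field.
  rewrite -(pmulr_rge0 _ s21_gt0); move: sv; rewrite xE vE; lra.
by rewrite divr_ge0 ?subr_ge0// ltW.
Qed.

Lemma normr_sign (d c : R) : d ^+ 2 = 1 -> 0 <= c -> `|d * c| = c.
Proof.
move=> d2 c_ge0; rewrite normrM (ger0_norm c_ge0).
have /eqP -> : `|d| == 1 by rewrite -sqr_norm_eq1 d2.
exact: mul1r.
Qed.

(* The segment runs in the direction [(s, 1)], normal to the edge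
   [v = s * (L - x)], from that edge to the vertical line [x = L]. *)
Lemma le_normal_segment (x v : R) : `|x| < L ->
  s * (L - `|x|) <= `|v| -> `|v| < s * L + `|x| / s ->
  g x v <= 2^-1 * (x ^+ 2 + v ^+ 2)
           - (`|v| - s * (L - `|x|)) ^+ 2 / (2 * (s ^+ 2 + 1)).
Proof.
move=> xL vge vlt.
have [d [e [a [u [[d2 e2 a_ge0 u_ge0] [xE vE dx ev]]]]]] :=
  normal_foot xL vge vlt.
set B := leRHS; have BE : B = 2^-1 * ((a + s * u) ^+ 2 + (s * (L - a) + u) ^+ 2)
    - (s ^+ 2 + 1) * u ^+ 2 / 2.
  rewrite /B xE vE -(real_normK (num_real x)) -(real_normK (num_real v)) xE vE.
  by field.
have D_gt0 : 0 < L - a.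
  by move: xL; rewrite xE subr_gt0; apply: le_lt_trans; rewrite lerDl mulr_ge0// ltW.
have Dn0 : L - a != 0 by rewrite gt_eqF.
have t01 : 0 <= s * u / (L - a) <= 1.
  rewrite divr_ge0 ?mulr_ge0 ?(ltW s_gt0) ?(ltW D_gt0)//= ler_pdivrMr// mul1r.
  by move: xL; rewrite xE; lra.
(* Advancing from the foot by [(L - a) / s] times [(s, 1)] reaches [x = L] at this height. *)
have end_le := @le_outside (d * L) (e * ((s ^+ 2 + 1) * (L - a) / s)).
have foot_le := @le_elastic (d * a) (e * (s * (L - a))).
move: end_le foot_le; rewrite !normr_sign ?(ltW L_gt0) ?mulr_ge0 ?(ltW s_gt0) ?(ltW D_gt0)//.
rewrite !exprMn d2 e2 !mul1r => /(_ (lexx _)) end_le /(_ (lexx _)) foot_le.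
have := segment_le t01 end_le foot_le (B := B).
rewrite (_ : _ * (d * L) + _ = x); last by rewrite dx; field.
rewrite (_ : _ + _ * (e * (s * (L - a))) = v); last by rewrite ev; field; rewrite Dn0.
by apply; rewrite BE; field; rewrite ?Dn0 ?s_neq0.
Qed.

(** The bound from [le_horizontal] is constant along the top side, so interpolating between it and
    the apex value gives a function affine in [|v|] alone. *)
Lemma le_fan (x v : R) :
  s * L + `|x| / s <= `|v| -> `|v| <= (s ^+ 2 + 1) / s * L ->
  g x v <= s * L * `|v| - s ^+ 2 * L ^+ 2 / 2.
Proof.
move=> vge vle; have [e e2 ev] := sign_decomposition v.
(* [t] is the relative height of [|v|] between the apex at [s * L] and the top side, which lies
   [L / s] above it. *)
pose t := (`|v| - s * L) * s / L.
have xt : `|x| <= L * t.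
  move: vge; rewrite addrC -lerBrDr ler_pdivrMr// => /le_trans -> //.
  by rewrite le_eqVlt; apply/orP; left; apply/eqP; rewrite /t; field.
have t_ge0 : 0 <= t by rewrite -(pmulr_rge0 _ L_gt0) (le_trans _ xt).
have t01 : 0 <= t <= 1.
  rewrite t_ge0 /t ler_pdivrMr// -ler_pdivlMr// lerBlDr (le_trans vle)//.
  by rewrite le_eqVlt; apply/orP; left; apply/eqP; field.
(* At the apex [t = 0]; there [x / t] is [0] by convention, which is harmless since [xt] forces
   [x = 0]. *)
have txt : t * (x / t) + (1 - t) * 0 = x.
  rewrite mulr0 addr0; have [t0|tn0] := eqVneq t 0; last by field.
  by move: xt; rewrite t0 mulr0 normr_le0 mul0r => /eqP.
have xtL : `|x / t| <= L.
  have [t0|tn0] := eqVneq t 0; first by rewrite t0 invr0 mulr0 normr0 ltW.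
  rewrite normrM normfV (ger0_norm t_ge0) ler_pdivrMr//.
  by rewrite lt_def tn0.
have top_le := @le_horizontal (x / t) (e * ((s ^+ 2 + 1) / s * L)) xtL.
have apex_le := @le_elastic 0 (e * (s * L)).
move: top_le apex_le; rewrite normr0 subr0 normr_sign ?mulr_ge0 ?(ltW s_gt0) ?(ltW L_gt0)//.
rewrite !exprMn e2 !mul1r => top_le /(_ (lexx _)) apex_le.
have := segment_le t01 top_le apex_le (B := s * L * `|v| - s ^+ 2 * L ^+ 2 / 2).
rewrite txt (_ : _ + _ * (e * (s * L)) = v); last first.
  by rewrite [RHS]ev /t; field; rewrite L_neq0.
by apply; rewrite /t; field; rewrite ?L_neq0 ?s_neq0.
Qed.

(** * Matching lower bounds: maximality of the envelope is used through affine minorants only *)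

Hypothesis rho_ge0 : forall x, 0 <= rho x.
Hypothesis affine_le : forall a p q : R,
  (forall x v : R, a + p * x + q * v <= reduced_energy s rho x v) ->
  forall x v : R, a + p * x + q * v <= g x v.

Lemma quadratic_le (x v : R) :
  2^-1 * x ^+ 2 + 2^-1 * (s ^+ 2 / (s ^+ 2 + 1)) * v ^+ 2 <= g x v.
Proof.
set k := s ^+ 2 / (s ^+ 2 + 1).
have := @affine_le (- (2^-1 * x ^+ 2) - k * (2^-1 * v ^+ 2)) x (k * v).
move=> /(_ _ x v) min_le; apply: le_trans (min_le _) => [|x' v'].
  by rewrite le_eqVlt; apply/orP; left; apply/eqP; field.
have := quadratic_tangent_minorant s_gt0 rho_ge0 x v x' v'.
by apply: le_trans; rewrite -/k le_eqVlt; apply/orP; left; apply/eqP; field.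
Qed.

Lemma isotropic_tangent_le (x0 v0 x v : R) : `|v0| <= s * (L - `|x0|) ->
  x0 * x + v0 * v - 2^-1 * (x0 ^+ 2 + v0 ^+ 2) <= g x v.
Proof.
move=> v0_le; have := @affine_le (- (2^-1 * (x0 ^+ 2 + v0 ^+ 2))) x0 v0.
move=> /(_ _ x v) min_le; apply: le_trans (min_le _) => [|x' v'].
  by rewrite le_eqVlt; apply/orP; left; apply/eqP; field.
have := isotropic_tangent_minorant s_gt0 rho_ge x' v' v0_le.
by apply: le_trans; rewrite le_eqVlt; apply/orP; left; apply/eqP; field.
Qed.

Lemma plate_le (c x v : R) : s * L <= `|c| ->
  2^-1 * L ^+ 2 + c * v - c ^+ 2 * (s ^+ 2 + 1) / (2 * s ^+ 2) <= g x v.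
Proof.
move=> c_ge.
have := @affine_le (2^-1 * L ^+ 2 - c ^+ 2 * (s ^+ 2 + 1) / (2 * s ^+ 2)) 0 c.
move=> /(_ _ x v) min_le; apply: le_trans (min_le _) => [|x' v'].
  by rewrite le_eqVlt; apply/orP; left; apply/eqP; field.
have := plate_minorant s_gt0 L_gt0 rho_ge0 rho_ge x' v' c_ge.
by apply: le_trans; rewrite le_eqVlt; apply/orP; left; apply/eqP; field.
Qed.

Lemma outside_eq (x v : R) : L <= `|x| ->
  g x v = 2^-1 * x ^+ 2 + 2^-1 * (s ^+ 2 / (s ^+ 2 + 1)) * v ^+ 2.
Proof. by move=> Lx; apply/le_anti; rewrite le_outside// quadratic_le. Qed.

Lemma elastic_eq (x v : R) : `|v| <= s * (L - `|x|) ->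
  g x v = 2^-1 * (x ^+ 2 + v ^+ 2).
Proof.
move=> vx; apply/le_anti; rewrite le_elastic//=.
apply: le_trans (isotropic_tangent_le _ _ vx).
by rewrite le_eqVlt; apply/orP; left; apply/eqP; field.
Qed.

(** The tangent at the foot attains the upper bound along the whole normal segment, because [(s, 1)]
    is the equality direction in Cauchy-Schwarz. *)
Lemma normal_segment_eq (x v : R) : `|x| < L ->
  s * (L - `|x|) <= `|v| -> `|v| < s * L + `|x| / s ->
  g x v = 2^-1 * (x ^+ 2 + v ^+ 2)
          - (`|v| - s * (L - `|x|)) ^+ 2 / (2 * (s ^+ 2 + 1)).
Proof.
move=> xL vge vlt; apply/le_anti; rewrite le_normal_segment//=.
have [d [e [a [u [[d2 e2 a_ge0 u_ge0] [xE vE dx ev]]]]]] :=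
  normal_foot xL vge vlt.
have La : 0 <= L - a.
  by rewrite subr_ge0 ltW// (le_lt_trans _ xL)// xE lerDl mulr_ge0// ltW.
have foot : `|e * (s * (L - a))| <= s * (L - `|d * a|).
  by rewrite !normr_sign// mulr_ge0// ltW.
apply: le_trans (isotropic_tangent_le _ _ foot).
rewrite -(real_normK (num_real x)) -(real_normK (num_real v)) xE vE {1}dx {1}ev.
rewrite le_eqVlt; apply/orP; left; apply/eqP.
rewrite !exprMn d2 e2 (mulrACA d) (mulrACA e) -!expr2 d2 e2.
by field.
Qed.

(** A single plate of the smallest admissible slope, [s * L] up to sign, touches the whole fan. *)
Lemma fan_eq (x v : R) :
  s * L + `|x| / s <= `|v| -> `|v| <= (s ^+ 2 + 1) / s * L ->
  g x v = s * L * `|v| - s ^+ 2 * L ^+ 2 / 2.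
Proof.
move=> vge vle; apply/le_anti; rewrite le_fan//=.
have [e e2 ev] := sign_decomposition v.
have sL_ge0 : 0 <= s * L by rewrite mulr_ge0// ltW.
have c_ge : s * L <= `|e * (s * L)| by rewrite normr_sign.
apply: le_trans (plate_le x v c_ge); rewrite {2}ev.
rewrite le_eqVlt; apply/orP; left; apply/eqP.
rewrite exprMn (mulrACA e) -expr2 e2.
by field.
Qed.

(** The plate has the slope of the parabola at [v]; the lower bound on [|v|] says precisely that
    this slope is admissible. *)
Lemma horizontal_eq (x v : R) : `|x| <= L -> (s ^+ 2 + 1) / s * L <= `|v| ->
  g x v = 2^-1 * L ^+ 2 + 2^-1 * (s ^+ 2 / (s ^+ 2 + 1)) * v ^+ 2.
Proof.
move=> xL vge; apply/le_anti; rewrite le_horizontal//=.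
have k_gt0 : 0 < s ^+ 2 / (s ^+ 2 + 1) by rewrite divr_gt0 ?exprn_gt0.
have c_ge : s * L <= `|s ^+ 2 / (s ^+ 2 + 1) * v|.
  rewrite normrM gtr0_norm// -ler_pdivrMl// (le_trans _ vge)//.
  by rewrite le_eqVlt; apply/orP; left; apply/eqP; field; rewrite ?s21_neq0 ?s_neq0.
apply: le_trans (plate_le x v c_ge).
by rewrite le_eqVlt; apply/orP; left; apply/eqP; field; rewrite ?s21_neq0 ?s_neq0.
Qed.

End ReducedEnvelope.

(** * Existence of the envelope as the pointwise supremum of all convex minorants *)

Lemma convex_envelope_exists (R : realType) (E : lmodType R) (f h0 : E -> R) :
  convex_function (E := E) setT h0 -> (forall y, h0 y <= f y) ->
  exists fc, is_convex_envelope f fc.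
Proof.
move=> h0_convex h0_le.
pose H := [set h : E -> R | convex_function (E := E) setT h /\ forall y, h y <= f y].
pose S y := [set h y | h in H].
(* [h0] makes every set of values nonempty and [f] bounds it, so each [sup] is a genuine
   supremum. *)
have H0 : H h0 by [].
have S_ub y : ubound (S y) (f y) by move=> _ [h [_ hf] <-].
have S0 y : S y !=set0 by exists (h0 y), h0.
have S_sup y : has_sup (S y) by split; [exact: S0 | exists (f y)].
have le_S h y : H h -> h y <= sup (S y).
  by move=> Hh; apply: sup_upper_bound => //; exists h.
exists (fun y => sup (S y)); split.
- move=> t x y _ _; apply: ge_sup => // _ [h [hc hf] <-].
  apply: le_trans (hc t x y _ _) _; rewrite ?inE//.
  have Hh : H h by [].
  have t_le1 : 0 <= 1 - t%:num by rewrite subr_ge0.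
  by rewrite !convRE; apply: lerD; apply: ler_wpM2l => //; exact: le_S.
- by move=> y; apply: ge_sup.
- by move=> h hc hf y; apply: le_S.
Qed.

Lemma affine_convex (R : realType) (a p q : R) :
  convex_function (E := (R^o * R^o)%type) setT
    (fun y : R * R => a + p * y.1 + q * y.2).
Proof.
move=> t x y _ _; rewrite le_eqVlt; apply/orP; left; apply/eqP.
rewrite !convRE/= /unstable.onem; case: x y => [x1 x2] [y1 y2] /=.
by rewrite /GRing.scale/=; ring.
Qed.

Lemma convex_functionP (R : realType) (h : R * R -> R) (t x x' v v' : R) :
  convex_function (E := (R^o * R^o)%type) setT h -> 0 <= t <= 1 ->
  h (t * x + (1 - t) * x', t * v + (1 - t) * v')
    <= t * h (x, v) + (1 - t) * h (x', v').
Proof.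
move=> hc /andP[t0 t1].
have := hc (Itv01 t0 t1) (x, v) (x', v'); rewrite !inE => /(_ Logic.I Logic.I).
by [].
Qed.

(** * Consequences of admissibility of [r] *)

Section Dissipation.
Context {R : realType} (s ymin ymax : R) (r : R -> R).
Hypotheses (s_gt0 : 0 < s) (ymin_lt_ymax : ymin < ymax).
Hypothesis r_adm : dissipation ymin ymax r.

(** The set where [r] is nonzero is open and contained in the closed interval, hence in its
    interior; this also excludes the endpoints. *)
Lemma dissipation_out (t : R) : t <= ymin \/ ymax <= t -> r t = 0.
Proof.
have [r_cont _ r_supp _] := r_adm.
move=> t_out; apply/eqP; apply: contrapT => /negP rt.
have open_rt : open [set u | r u != 0].
  have -> : [set u | r u != 0] = r @^-1` [set~ 0].
    by apply/seteqP; split => u /=; [move/eqP | move=> ?; apply/eqP].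
  apply: open_comp; first by move=> u _; exact: r_cont.
  by rewrite openC; exact: closed_eq.
have sub : [set u | r u != 0] `<=` `[ymin, ymax]%classic.
  by rewrite -r_supp; exact: subset_closure.
have : interior `[ymin, ymax]%classic t.
  by move: sub; rewrite open_subsetE//; apply.
rewrite interior_itv_bnd/= in_itv/= => /andP[]; case: t_out; lra.
Qed.

(** Inside, concavity is applied between the midpoint and an endpoint, where [r] is nonnegative;
    outside, the left side is negative. *)
Lemma dissipation_ge (x : R) :
  s * ((ymax - ymin) / 2) <= r ((ymin + ymax) / 2) ->
  s * ((ymax - ymin) / 2 - `|x|) <= r ((ymin + ymax) / 2 + x).
Proof.
set L := (ymax - ymin) / 2; set m := (ymin + ymax) / 2 => r_mid.
have L_gt0 : 0 < L by rewrite divr_gt0// subr_gt0.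
have L_neq0 : L != 0 by rewrite gt_eqF.
have [_ r_ge0 _ r_concave] := r_adm.
have [xL|Lx] := leP `|x| L; last first.
  apply: le_trans (r_ge0 (m + x)).
  by rewrite pmulr_rle0// subr_le0 ltW.
have [d d2 dx] := sign_decomposition x.
have t0 : 0 <= `|x| / L by rewrite divr_ge0// ltW.
have t1 : `|x| / L <= 1 by rewrite ler_pdivrMr// mul1r.
have dL : `|d * L| <= L by rewrite normr_sign// ltW.
have memD z : `|z| <= L -> m + z \in (`[ymin, ymax]%classic : set R).
  by rewrite inE/= in_itv/= ler_norml /m /L => /andP[? ?]; apply/andP; split; lra.
have := r_concave (Itv01 t0 t1) (m + d * L) (m + 0).
rewrite !convRE/= => /(_ (memD _ dL)); rewrite memD ?normr0 ?(ltW L_gt0)// => /(_ isT).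
have -> : (conv (Itv01 t0 t1) (m + d * L : convex_lmodType R^o) (m + 0) : R) = m + x.
  rewrite [RHS](_ : _ = m + d * `|x|); last by rewrite -dx.
  rewrite -[LHS]/(`|x| / L * (m + d * L) + (1 - `|x| / L) * (m + 0)).
  by field.
have := r_ge0 (m + d * L); rewrite addr0 /unstable.onem => rd0.
have : 0 <= `|x| / L * r (m + d * L) by rewrite mulr_ge0.
have : (1 - `|x| / L) * (s * L) <= (1 - `|x| / L) * r m.
  by rewrite ler_wpM2l// subr_ge0.
rewrite (_ : _ * (s * L) = s * (L - `|x|)); last by field.
lra.
Qed.

End Dissipation.

(** * Return to the original coordinates *)

Lemma condensed_energy_shift (R : realType) (s b m x v : R) (r : R -> R) :
  s ^+ 2 = b ->
  condensed_energy b r (m + x, v)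
    = m * x + 2^-1 * m ^+ 2 + reduced_energy s (fun z => r (m + z)) x v.
Proof.
move=> <-; rewrite /condensed_energy /reduced_energy /=; field.
by rewrite gt_eqF// ltr_wpDl ?sqr_ge0.
Qed.

Lemma r0_in (R : realType) (b ymin ymax t : R) : ymin <= t <= ymax ->
  r0 b ymin ymax t
    = Num.sqrt b * ((ymax - ymin) / 2 - `|t - (ymin + ymax) / 2|).
Proof. by move=> t_in; rewrite /r0 indicE mem_set ?mulr1//= in_itv. Qed.

(** [Y1] does not restrict [y.1] explicitly; positivity of [r0] supplies the range. *)
Lemma r0_gt0_in (R : realType) (b ymin ymax t : R) :
  0 < r0 b ymin ymax t -> ymin <= t <= ymax.
Proof.
rewrite /r0 indicE; case: (boolP (t \in _)) => [|_]; last by rewrite mulr0 ltxx.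
by rewrite inE /= in_itv.
Qed.

Theorem theorem1 (R : realType) (b ymin ymax : R) (r : R -> R)
    (b_gt0 : 0 < b) (ymin_lt_ymax : ymin < ymax)
    (r_adm : dissipation ymin ymax r)
    (r_mid : Num.sqrt b * ((ymax - ymin) / 2) <= r ((ymin + ymax) / 2)) :
  exists2 fc : R * R -> R,
    is_convex_envelope (E := (R^o * R^o)%type) (condensed_energy b r) fc &
    [/\ forall y : R * R, Ytilde ymin ymax y ->
          fc y = 2^-1 * y.1 ^+ 2 + 2^-1 * (b / (b + 1)) * y.2 ^+ 2,
        forall y : R * R, Y1 b ymin ymax y ->
          fc y = 2^-1 * y.1 ^+ 2 + 2^-1 * y.2 ^+ 2,
        forall y : R * R, Y2 b ymin ymax y ->
          fc y = 2^-1 * y.1 ^+ 2 + 2^-1 * y.2 ^+ 2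
                 - (`|y.2| - r0 b ymin ymax y.1) ^+ 2 / (2 * (b + 1)),
        forall y : R * R, Y3 b ymin ymax y ->
          fc y = 2^-1 * y.1 ^+ 2 + 2^-1 * y.2 ^+ 2
                 - (`|y.2| - r0 b ymin ymax y.1) ^+ 2 / (2 * (b + 1))
                 - 2^-1 * (b / (b + 1)) *
                   (`|y.2| - (b + 1) / Num.sqrt b * ((ymax - ymin) / 2)
                    + r0 b ymin ymax y.1 / b) ^+ 2
      & forall y : R * R, Y4 b ymin ymax y ->
          fc y = 2^-1 * y.1 ^+ 2 + 2^-1 * (b / (b + 1)) * y.2 ^+ 2
                 + 2^-1 * ((y.1 - ymin) * (ymax - y.1))].
Proof.
pose s : R := Num.sqrt b; pose m := (ymin + ymax) / 2; pose L := (ymax - ymin) / 2.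
have s_gt0 : 0 < s by rewrite sqrtr_gt0.
have s2 : s ^+ 2 = b by rewrite sqr_sqrtr// ltW.
have s_neq0 : s != 0 by rewrite gt_eqF.
have s21_neq0 : s ^+ 2 + 1 != 0 by rewrite gt_eqF// ltr_wpDl ?sqr_ge0.
have L_gt0 : 0 < L by rewrite divr_gt0// subr_gt0.
pose rho x := r (m + x).
have rho_ge0 x : 0 <= rho x by have [_ r_ge0 _ _] := r_adm; exact: r_ge0.
have rho_ge (x : R) : s * (L - `|x|) <= rho x.
  exact: (dissipation_ge s_gt0 ymin_lt_ymax r_adm).
have rho_out (x : R) : L <= `|x| -> rho x = 0.
  move=> Lx; apply: (dissipation_out r_adm); move: Lx.
  by rewrite /m /L ler_normr => /orP[] Lx; [right|left]; lra.
(* The coefficients result from adding [m * x + 2^-1 * m ^+ 2] and substituting [x = y.1 - m]. *)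
have affine_le_energy (a p q : R) :
    (forall x v : R, a + p * x + q * v <= reduced_energy s rho x v) ->
  forall y, (a - 2^-1 * m ^+ 2 - p * m) + (m + p) * y.1 + q * y.2
            <= condensed_energy b r y.
  move=> min_le [y1 v] /=; rewrite -[y1](subrKC m) (condensed_energy_shift _ _ _ _ s2).
  by have := min_le (y1 - m) v; rewrite -/rho; lra.
have [fc fc_env] : exists fc : R * R -> R,
    is_convex_envelope (E := (R^o * R^o)%type) (condensed_energy b r) fc.
  (* The tangent at the origin is zero, which provides a first convex minorant. *)
  have zero_le x v : 0 + 0 * x + 0 * v <= reduced_energy s rho x v.
    have := quadratic_tangent_minorant s_gt0 rho_ge0 0 0 x v.
    by rewrite !mul0r expr0n /= !mulr0 !(subr0, addr0, mulr0).
  exact: convex_envelope_exists (affine_convex _ _ _) (affine_le_energy _ _ _ zero_le).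
exists fc => //; case: fc_env => fc_convex fc_le fc_max.
pose g x v := fc (m + x, v) - m * x - 2^-1 * m ^+ 2.
have g_convex (t x x' v v' : R) : 0 <= t <= 1 ->
    g (t * x + (1 - t) * x') (t * v + (1 - t) * v')
      <= t * g x v + (1 - t) * g x' v'.
  move=> t01; have := convex_functionP (m + x) (m + x') v v' fc_convex t01.
  by rewrite (_ : _ + _ = m + (t * x + (1 - t) * x')) /g; [lra | ring].
have g_le x v : g x v <= reduced_energy s rho x v.
  have := fc_le (m + x, v).
  by rewrite (condensed_energy_shift _ _ _ _ s2) /g -/rho; lra.
have affine_le (a p q : R) :
    (forall x v : R, a + p * x + q * v <= reduced_energy s rho x v) ->
  forall x v : R, a + p * x + q * v <= g x v.
  move=> min_le x v.
  have := fc_max _ (affine_convex _ _ _) (affine_le_energy _ _ _ min_le) (m + x, v).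
  by rewrite /g /=; lra.
have fcE y : fc y = g (y.1 - m) y.2 + m * (y.1 - m) + 2^-1 * m ^+ 2.
  by case: y => y1 v; rewrite /g /= subrKC; ring.
have inside y1 : ymin < y1 < ymax -> `|y1 - m| < L /\ r0 b ymin ymax y1 = s * (L - `|y1 - m|).
  move=> /andP[y1_gt y1_lt]; split; last by rewrite r0_in ?ltW.
  by rewrite ltr_norml /m /L; apply/andP; split; lra.
split=> -[y1 v].
- rewrite /Ytilde /= => y_out; rewrite fcE (outside_eq s_gt0 rho_out g_le rho_ge0 affine_le)//.
    by rewrite -s2 /=; field.
  by rewrite ler_normr /m /L /=; apply/orP; case: y_out => ?; [right|left]; lra.
- rewrite /Y1 /= => v_lt; have y1_in := r0_gt0_in (le_lt_trans (normr_ge0 v) v_lt).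
  move: v_lt; rewrite r0_in// => /ltW v_le; rewrite fcE.
  by rewrite (elastic_eq s_gt0 rho_ge g_le affine_le)//=; field.
- rewrite /Y2 /= => -[/inside[xL ->] /andP[v_ge v_lt]].
  rewrite fcE (normal_segment_eq s_gt0 L_gt0 rho_ge rho_out g_convex g_le affine_le)//=.
    by rewrite -s2; field.
  (* With [r0] equal to [s * (L - |x|)], the threshold between [Y2] and [Y3] becomes
     [s * L + |x| / s]. *)
  apply: (lt_le_trans v_lt); rewrite -/s -/L -s2 le_eqVlt.
  by apply/orP; left; apply/eqP; field.
- rewrite /Y3 /= => -[/inside[xL ->] /andP[v_ge v_le]].
  rewrite fcE (fan_eq s_gt0 L_gt0 rho_ge rho_out g_convex g_le rho_ge0 affine_le)//=.
  + rewrite -/s -/L -s2 -(real_normK (num_real v)).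
    set a := `|y1 - m|; have a2 : (y1 - m) ^+ 2 = a ^+ 2 by rewrite real_normK ?num_real.
    rewrite (_ : y1 ^+ 2 = a ^+ 2 + 2 * m * (y1 - m) + m ^+ 2); last by rewrite -a2; ring.
    by field; rewrite s_neq0 s21_neq0.
  + apply: le_trans v_ge; rewrite -/s -/L -s2 le_eqVlt.
    by apply/orP; left; apply/eqP; field.
  + by rewrite s2.
- rewrite /Y4 /= => -[/inside[xL _] v_gt].
  rewrite fcE (horizontal_eq s_gt0 L_gt0 rho_ge rho_out g_convex g_le rho_ge0 affine_le)//= ?(ltW xL)//.
    (* Here [L ^+ 2 - (y1 - m) ^+ 2] factors as [(y1 - ymin) * (ymax - y1)]. *)
    by rewrite -s2 /m /L; field.
  by rewrite s2 ltW.
Qed.
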